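(* Let $\kappa$ be an inaccessible cardinal, let $\mathcal I$ be an ideal on $\kappa$ extending the bounded ideal, let $U$ be a $\sigma$-complete ultrafilter on $\kappa$ extending the dual filter $\mathcal I^*$, and let $h:\kappa\to\kappa$ be any function. Then: (1) $\mathfrak{b}_{h}(\in^{\mathcal I})\leq\left|([h]_U^+)^{M_U}\right|^V\leq [h]_U^+$. (2) $\mathfrak{d}_h(\in^{\mathcal I})<2^\kappa$ implies $2^\kappa=|[h]_U|^V$.
   Context: $M_U$ is the transitive collapse of the ultrapower of $V$ by $U$, and $[h]_U\in M_U$ is the ordinal represented by $h$; $([h]_U^+)^{M_U}$ is the least cardinal of $M_U$ greater than $[h]_U$, $[h]_U^+$ is the least cardinal of $V$ greater than $[h]_U$, and $|\cdot|^V$ denotes cardinality in $V$. The bounded ideal is the ideal of bounded subsets of $\kappa$. Functions $h:\kappa\to\kappa$ are assumed to take no finite values. An $h$-slalom is a function $\varphi$ whose domain is a subset of $\kappa$ with bounded complement, such that $\varphi(\alpha)\subseteq\kappa$ and $|\varphi(\alpha)|=|h(\alpha)|$ for all $\alpha\in\mathrm{dom}(\varphi)$. For $f:\kappa\to\kappa$, write $f\in^{\mathcal I}\varphi$ if $\{\alpha\in\mathrm{dom}(\varphi): f(\alpha)\notin\varphi(\alpha)\}\in\mathcal I$. $\mathfrak{b}_h(\in^{\mathcal I})$ is the least cardinality of a family $\mathcal F\subseteq\kappa^\kappa$ such that for every $h$-slalom $\varphi$ there is $f\in\mathcal F$ with $\neg(f\in^{\mathcal I}\varphi)$. $\mathfrak{d}_h(\in^{\mathcal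 I})$ is the least cardinality of a family $\mathcal A$ of $h$-slaloms such that for every $f\in\kappa^\kappa$ there is $\varphi\in\mathcal A$ with $f\in^{\mathcal I}\varphi$. *)

(* Defs.v *)
From HB Require Import structures.
From mathcomp Require Import all_boot.
From mathcomp Require Import boolp classical_sets functions cardinality filter.

Set Implicit Arguments.
Unset Strict Implicit.
Unset Printing Implicit Defensive.

Local Open Scope classical_set_scope.
Local Open Scope card_scope.

Reserved Notation "x \inV y" (at level 70, no associativity).
Reserved Notation "x <=V y" (at level 70, no associativity).

(* The universe of sets: a class model of ZFC whose classes are the predicates
   on V, so that replacement is stated for every functional class relation (and
   entails separation for every class).  The base point is only the junk value
   of definite descriptions [get P]. *)
HB.mixin Record isZFC V of Pointed V := {
  mem : V -> V -> Prop;
  zfc_extensionality : forall x y, (forall z, mem z x <-> mem z y) -> x = y;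
  zfc_foundation : forall x, (exists y, mem y x) ->
    exists y, mem y x /\ forall z, mem z y -> ~ mem z x;
  zfc_pairing : forall x y, exists p, forall z, mem z p <-> z = x \/ z = y;
  zfc_union : forall x, exists u, forall z,
    mem z u <-> exists y, mem y x /\ mem z y;
  zfc_powerset : forall x, exists p, forall y,
    mem y p <-> forall z, mem z y -> mem z x;
  zfc_infinity : exists w,
    (exists e, mem e w /\ forall z, ~ mem z e) /\
    (forall x, mem x w -> exists s, mem s w /\
      forall z, mem z s <-> mem z x \/ z = x);
  zfc_replacement : forall R : V -> V -> Prop,
    (forall x y z, R x y -> R x z -> y = z) ->
    forall a, exists b, forall y, mem y b <-> exists x, mem x a /\ R x y;
  zfc_choice : forall a,
    (forall x, mem x a -> exists z, mem z x) ->
    (forall x y z, mem x a -> mem y a -> mem z x -> mem z y -> x = y) ->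
    exists c, forall x, mem x a -> exists! z, mem z x /\ mem z c
}.

#[short(type="zfcType")]
HB.structure Definition ZFC := {V of isZFC V & Pointed V}.

Notation "x \inV y" := (mem x y).

Section Ordinals.
Variable V : zfcType.
Implicit Types (a b c x y p f : V) (M : set V).

Definition elts a : set V := [set x | x \inV a].

(* The type of elements of a. *)
Definition El a : Type := {x : V | x \inV a}.

Definition elt_val a (x : El a) : V := proj1_sig x.

Definition transitive_set a : Prop :=
  forall x y, x \inV a -> y \inV x -> y \inV a.

(* Von Neumann ordinals; \inV is well-founded by foundation. *)
Definition ordinal_set a : Prop :=
  [/\ transitive_set a &
      forall x y, x \inV a -> y \inV a -> [\/ x \inV y, x = y | y \inV x]].

(* The order of ordinals. *)
Definition leV a b : Prop := a \inV b \/ a = b.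

Definition least (P : set V) : V :=
  get [set c | P c /\ forall d, P d -> leV c d].

(* p is the Kuratowski pair {{x}, {x, y}}. *)
Definition is_opair p x y : Prop :=
  forall z, z \inV p <->
    (forall w, w \inV z <-> w = x) \/ (forall w, w \inV z <-> w = x \/ w = y).

Definition maps_to f x y : Prop := exists2 p, p \inV f & is_opair p x y.

Definition bijection_from_to f a b : Prop :=
  [/\ forall p, p \inV f ->
        exists x y, [/\ x \inV a, y \inV b & is_opair p x y],
      forall x, x \inV a -> exists! y, maps_to f x y &
      forall y, y \inV b -> exists! x, maps_to f x y].

(* c is a cardinal in the sense of the transitive class M.  The notions
   [ordinal_set] and [bijection_from_to] are Delta_0, so that they need not be
   relativized to M; V itself is the class [setT]. *)
Definition cardinal_in M c : Prop :=
  [/\ M c, ordinal_set c &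
      forall b f, b \inV c -> M f -> ~ bijection_from_to f b c].

(* (a^+)^M: the least cardinal of M greater than a *)
Definition succ_card_in M a : V :=
  least [set c | cardinal_in M c /\ a \inV c].

Definition cardinalV c : Prop := cardinal_in setT c.

Definition succ_card a : V := succ_card_in setT a.

(* |A|: the cardinal of V equipotent with A.  By replacement a bijection between
   the elements of a set and A exists iff it does as a set of V. *)
Definition cardinal_of T (A : set T) : V := get [set c | cardinalV c /\ elts c #= A].

End Ordinals.

Arguments elt_val {V a} x.
Arguments cardinal_of {V T} A.

Notation "x <=V y" := (leV x y).

Section Kappa.
Variables (V : zfcType) (kappa : V).
Local Notation K := (El kappa).
Implicit Types (A : set K) (I U : set_system K) (h : K -> K).

Definition bounded_ideal : set_system K :=
  [set A | exists b : K, forall a, A a -> elt_val a \inV elt_val b].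

Definition cofinality : V :=
  least [set c | exists A, ~ bounded_ideal A /\ c = cardinal_of A].

Definition pow2 (l : V) : V := cardinal_of [set: El l -> bool].

Definition inaccessible : Prop :=
  [/\ cardinalV kappa,
      ~ countable (elts kappa),
      cofinality = kappa &
      forall l, cardinalV l -> l \inV kappa -> pow2 l \inV kappa].

Definition is_ideal I : Prop :=
  [/\ I set0,
      ~ I setT,
      forall A B, A `<=` B -> I B -> I A &
      forall A B, I A -> I B -> I (A `|` B)].

Definition dual_filter I : set_system K := [set A | I (~` A)].

Definition sigma_complete U : Prop :=
  forall A : nat -> set K, (forall n, U (A n)) -> U (\bigcap_n A n).

(* Membership in the ultrapower of V by U, on representatives. *)
Definition ult_mem U (g f : K -> V) : Prop :=
  U [set al | g al \inV f al].

(* [f]_U, the image of the class of f under the transitive collapse.  Functions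
   that are equal modulo U have the same [ult_mem]-predecessors, hence the same
   image, so that the collapsing map can be given on representatives. *)
Definition is_collapse U (pi : (K -> V) -> V) : Prop :=
  forall f x, x \inV pi f <-> exists2 g, ult_mem U g f & pi g = x.

Definition collapse U : (K -> V) -> V := get [set pi | is_collapse U pi].

(* M_U *)
Definition ultrapower U : set V := range (collapse U).

(* [h]_U for h : kappa -> kappa *)
Definition ult_class U h : V := collapse U (fun al => elt_val (h al)).

(* Partial functions from kappa to subsets of kappa are represented by total
   functions to the option type, with value None outside of the domain. *)
Definition slalom_dom (phi : K -> option (set K)) : set K :=
  [set al | phi al <> None].

Definition slalom h : set (K -> option (set K)) :=
  [set phi | bounded_ideal (~` slalom_dom phi) /\
    forall al S, phi al = Some S -> S #= elts (elt_val (h al))].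

Definition localized I (f : K -> K) (phi : K -> option (set K)) : Prop :=
  I [set al | exists2 S, phi al = Some S & ~ S (f al)].

Definition b_slalom h I : V :=
  least [set c | exists F : set (K -> K),
    (forall phi, slalom h phi -> exists2 f, F f & ~ localized I f phi) /\
    c = cardinal_of F].

Definition d_slalom h I : V :=
  least [set c | exists A : set (K -> option (set K)),
    [/\ A `<=` slalom h,
        forall f : K -> K, exists2 phi, A phi & localized I f phi &
        c = cardinal_of A]].

End Kappa.

Arguments bounded_ideal {V kappa} _.

(* Main.v *)
Require Import Defs.
From HB Require Import structures.
From mathcomp Require Import all_boot.
From mathcomp Require Import boolp classical_sets functions cardinality filter.
From mathcomp Require Import wochoice.

Set Implicit Arguments.
Unset Strict Implicit.
Unset Printing Implicit Defensive.

Local Open Scope classical_set_scope.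
Local Open Scope card_scope.

(** A slalom becomes, in the ultrapower, a set of size at most that of [h]_U,
    and a function that it localizes modulo I becomes one of its elements,
    because U contains the dual filter of I.  Both parts count such elements.

    For (1), let h+ send al to the successor cardinal of h(al), which is below
    kappa since kappa is a strong limit.  No slalom can localize a family that
    represents every element of [h+]_U: on the domain of a slalom phi, h+(al) is
    not covered by phi(al), so that a choice of points of h+(al) outside phi(al)
    represents an element of [h+]_U, and the member of the family with the same
    class escapes phi on a set in U ([b_slalom_le]).  The size of such a family
    is at most that of the least M_U-cardinal lambda above [h]_U, because
    [h+]_U <= lambda ([ult_hplus_le]): an ordinal of M_U between [h]_U and
    [h+]_U is the class of some g with h(al) < g(al) < h+(al) almost everywhere,
    and the class of a choice of bijections from h(al) to g(al) is a bijection
    in M_U.  The bound lambda <= [h]_U^+ holds because a cardinal of V that lies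
    in M_U, as all ordinals do, is a cardinal of M_U.

    For (2), since 2^l < kappa for l < kappa, the initial pieces of a subset X
    of kappa can be coded below kappa, which gives 2^kappa functions f_X that
    are pairwise different at all large arguments
    ([eventually_different_family]) and therefore have different classes.  Given
    a family A of slaloms that localizes all functions, fix bijections of the
    sets phi(al) with h(al); sending X to a slalom phi in A that localizes f_X
    and to the class of the image of f_X under these bijections injects 2^kappa
    into the product of A and [h]_U ([bool_fun_le_slaloms]).  As m * m = m for
    infinite m ([card_square_le]), if A has fewer than 2^kappa elements, then
    2^kappa <= |[h]_U|, and the converse bound follows from kappa^kappa =
    2^kappa.

    The ultrapower is handled without the general theorem of Los: sigma
    completeness makes the membership relation on representatives well-founded,
    and the collapse commutes with pairs, hence preserves bijections.  Cardinal
    arithmetic is done with subsets of arbitrary types; the ones that are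
    equipotent with a set of V have a cardinal in V, obtained by collapsing a
    well-order. *)

(** * Cardinalities of subsets of types *)

(** An injection given as a relation needs no default value in the target, so
    that this form applies to arbitrary types, and no choice of images. *)
Lemma card_le_relP T U (A : set T) (B : set U) :
  A #<= B <-> exists R : T -> U -> Prop,
    (forall x, A x -> exists2 y, B y & R x y) /\
    (forall x x' y, A x -> A x' -> R x y -> R x' y -> x = x').
Proof.
split=> [|[R [Rex Rinj]]].
  have [[u]|noU] := pselect (inhabited U).
    pose PU : pointedType := HB.pack U (gen_eqMixin U) (gen_choiceMixin U)
      (isPointed.Build U u).
    move=> AB; have /pcard_leP/injfunPex[f fAB finj] := AB : card_le A (B : set PU).
    exists (fun x y => f x = y); split=> [x Ax|x x' y Ax Ax' fx fx'].
      by exists (f x) => //; exact: fAB.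
    by apply: finj; rewrite ?inE//; rewrite fx.
  have -> : B = set0 by apply/seteqP; split=> // u _; apply: noU; exists.
  move=> /card_le0P ->; exists (fun _ _ => True); by split=> // x [].
have [->//|/set0P[a Aa]] := eqVneq A set0.
have [b Bb _] := Rex a Aa.
have Rex' x : exists y, A x -> B y /\ R x y.
  have [Ax|nAx] := pselect (A x); last by exists b.
  by have [y By Rxy] := Rex x Ax; exists y.
have [f fP] := choice Rex'.
pose PU : pointedType := HB.pack U (gen_eqMixin U) (gen_choiceMixin U)
  (isPointed.Build U b).
suff : card_le A (B : set PU) by [].
apply/pcard_leP/injfunPex; exists (f : T -> PU) => [x /fP[]//|x x'].
rewrite !inE => Ax Ax' ff.
apply: (Rinj x x' (f x)) => //; first exact: (fP x Ax).2.
by rewrite ff; exact: (fP x' Ax').2.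
Qed.

Lemma card_le_inj T U (A : set T) (B : set U) (f : T -> U) :
  (forall x, A x -> B (f x)) ->
  (forall x y, A x -> A y -> f x = f y -> x = y) -> A #<= B.
Proof.
move=> fAB finj; apply/card_le_relP; exists (fun x y => f x = y).
split=> [x Ax|x x' y Ax Ax' fx fx']; first by exists (f x) => //; exact: fAB.
by apply: finj => //; rewrite fx.
Qed.

Lemma card_le_funP T (U : pointedType) (A : set T) (B : set U) : A #<= B ->
  exists2 f : T -> U, (forall x, A x -> B (f x)) &
    (forall x y, A x -> A y -> f x = f y -> x = y).
Proof.
move=> /pcard_leP/injfunPex[f fAB finj]; exists f => // x y Ax Ay.
by apply: finj; rewrite inE.
Qed.

Lemma card_eq_funP T (U : pointedType) (A : set T) (B : set U) : A #= B ->
  exists f : T -> U, [/\ forall x, A x -> B (f x),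
    forall x y, A x -> A y -> f x = f y -> x = y &
    forall y, B y -> exists2 x, A x & f x = y].
Proof.
move=> /card_set_bijP[f [fAB finj fsurj]]; exists f; split=> // x y Ax Ay.
by apply: finj; rewrite inE.
Qed.

Lemma card_leX T T' U U' (A : set T) (A' : set T') (B : set U) (B' : set U') :
  A #<= A' -> B #<= B' -> A `*` B #<= A' `*` B'.
Proof.
move=> /card_le_relP[R [Rex Rinj]] /card_le_relP[S [Sex Sinj]]; apply/card_le_relP.
exists (fun p q => R p.1 q.1 /\ S p.2 q.2); split=> [[x y] /= [Ax By]|].
  have [x' ? ?] := Rex x Ax; have [y' ? ?] := Sex y By.
  by exists (x', y').
move=> [x y] [x' y'] [z w] /= [? ?] [? ?] [Rx Sy] [Rx' Sy'].
by rewrite (Rinj x x' z)// (Sinj y y' w).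
Qed.

Lemma infinite_setU1_le T (A : set T) (a : T) :
  infinite_set A -> a |` A #<= A.
Proof.
have [Aa|nAa] := pselect (A a).
  by move=> _; apply: subset_card_le => x [->|].
move=> /infiniteP/card_le_relP[S [Sex Sinj]].
have Sex' n : exists x, A x /\ S n x by have [x Ax Sx] := Sex n I; exists x.
have [s sP] := choice Sex'.
have s_inj m n : s m = s n -> m = n.
  move=> smn; apply: (Sinj m n (s m)) => //; first by case: (sP m).
  by rewrite smn; case: (sP n).
(* a shift of the sequence [s] makes room for [a] *)
pose R x y := [\/ x = a /\ y = s 0, (exists2 n, x = s n & y = s n.+1)
  | [/\ x <> a, forall n, x <> s n & y = x]].
apply/card_le_relP; exists R; split=> [x [->|Ax]|x x' y _ _].
- by exists (s 0); [case: (sP 0)|constructor 1].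
- have [[n xn]|nx] := pselect (exists n, x = s n).
    by exists (s n.+1); [case: (sP n.+1)|constructor 2; exists n].
  exists x => //; constructor 3; split=> // [xa|n xn]; first by rewrite xa in Ax.
  by apply: nx; exists n.
case=> [[-> ->]|[n -> ->]|[_ nx ->]].
- by case=> [[-> _]|[m _ /s_inj]|[_ nx e]] //; case: (nx 0).
- case=> [[_ /s_inj]|[m -> /s_inj[->]]|[_ nx e]] //.
  by case: (nx n.+1).
- by case=> [[_ e]|[m _ e]|[_ _ e]] //; [case: (nx 0)|case: (nx m.+1)].
Qed.

Lemma card_bool_fun_gt T : ~ ([set: T -> bool] #<= [set: T]).
Proof.
move=> /card_le_relP[R [Rex Rinj]].
(* Cantor's diagonal set, read through the injection *)
pose D t := `[< exists2 p : T -> bool, R p t & p t = false >].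
have [t _ Rt] := Rex D I; have := erefl (D t); rewrite {1}/D; case: asboolP.
  by move=> [p Rp pt]; rewrite -(Rinj p D t)// pt.
by move=> nD /esym Dt; apply: nD; exists D.
Qed.

Lemma wf_no_descent T (R : T -> T -> Prop) :
  (forall s : nat -> T, ~ forall n, R (s n.+1) (s n)) -> well_founded R.
Proof.
move=> nodesc x; apply: contrapT => nAx.
have nAcc_pred y : exists z, ~ Acc R y -> R z y /\ ~ Acc R z.
  have [Ay|nAy] := pselect (Acc R y); first by exists y => /(_ Ay).
  suff [z Rzy nAz] : exists2 z, R z y & ~ Acc R z by exists z.
  apply: contrapT => nz; apply: nAy; split=> z Rzy.
  by apply: contrapT => nAz; apply: nz; exists z.
have [f fP] := choice nAcc_pred.
have nA n : ~ Acc R (iter n f x) by elim: n => [//|n IH]; case: (fP _ IH).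
by apply: (nodesc (fun n => iter n f x)) => n /=; case: (fP _ (nA n)).
Qed.

(** * Sets of V and the types equipotent with them *)

Section SetFormation.
Variable V : zfcType.
Implicit Types (a b x y : V) (P : V -> Prop).

(** The subsets of types that replacement can treat as sets of V. *)
Definition small T (A : set T) : Prop := exists a : V, A #<= elts a.

(** The set of V with the extension P, meaningful when P is bounded by a set. *)
Definition setof P : V := get [set b | forall x, x \inV b <-> P x].

Lemma setext x y : (forall z, z \inV x <-> z \inV y) -> x = y.
Proof. exact: zfc_extensionality. Qed.

Lemma setofP a P : (forall x, P x -> x \inV a) ->
  forall x, x \inV setof P <-> P x.
Proof.
move=> Pa; have [|b bP] := @zfc_replacement V (fun x y => x = y /\ P x) _ a.
  by move=> x y z [<- _] [].
apply: (@getPex _ [set b | forall x, x \inV b <-> P x]); exists b => x.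
rewrite bP; split=> [[y [_ [<-]]]//|Px]; exists x; split=> //.
exact: Pa.
Qed.

Lemma small_elts a : small (elts a).
Proof. by exists a. Qed.

Lemma small_le T U (A : set T) (B : set U) : A #<= B -> small B -> small A.
Proof. by move=> AB [b Bb]; exists b; exact: card_le_trans Bb. Qed.

Lemma small_sub T (A B : set T) : A `<=` B -> small B -> small A.
Proof. by move=> AB; apply: small_le; exact: subset_card_le. Qed.

(** Replacement applied to the inverse of an injection of A into a set. *)
Lemma small_setof T (A : set T) (F : T -> V) : small A ->
  forall y, y \inV setof (F @` A) <-> (F @` A) y.
Proof.
move=> [a /card_le_funP[c ca c_inj]].
pose R x y := exists t, [/\ A t, c t = x & F t = y].
have [|b bP] := @zfc_replacement V R _ a.
  move=> x y z [t [At ct <-]] [t' [At' ct' <-]].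
  by rewrite (c_inj t t')// ct ct'.
apply: (@setofP b) => _ [t At <-]; apply/bP; exists (c t).
by split; [exact: ca|exists t].
Qed.

Definition upair x y : V := setof (fun z => z = x \/ z = y).

Lemma upairP x y z : z \inV upair x y <-> z = x \/ z = y.
Proof.
have [p pP] := zfc_pairing x y.
by apply: (@setofP p) => w; rewrite pP.
Qed.

Lemma upair_inj x y x' y' : upair x y = upair x' y' ->
  (x = x' /\ y = y') \/ (x = y' /\ y = x').
Proof.
move=> e; have exy z : z = x \/ z = y <-> z = x' \/ z = y'.
  by rewrite -!upairP e.
have := (exy x).1 (or_introl erefl); have := (exy y).1 (or_intror erefl).
have := (exy x').2 (or_introl erefl); have := (exy y').2 (or_intror erefl).
by do 4 (case=> ?; subst); by [left|right].
Qed.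

Definition opair x y : V := upair (upair x x) (upair x y).

Lemma opair_inj x y x' y' : opair x y = opair x' y' -> x = x' /\ y = y'.
Proof.
by move=> /upair_inj[[/upair_inj + /upair_inj]|[/upair_inj + /upair_inj]];
  do 2 (case=> -[? ?]; subst).
Qed.

Lemma is_opairE p x y : is_opair p x y <-> p = opair x y.
Proof.
have xx z : (forall w, w \inV z <-> w = x) <-> z = upair x x.
  split=> [zx|-> w]; last by rewrite upairP; split=> [[]|]//; left.
  by apply: setext => w; rewrite zx upairP; split=> [|[]]//; left.
have xy z : (forall w, w \inV z <-> w = x \/ w = y) <-> z = upair x y.
  split=> [zx|-> w]; last by rewrite upairP.
  by apply: setext => w; rewrite zx upairP.
split=> [pP|-> z]; last by rewrite upairP xx xy.
by apply: setext => z; rewrite pP upairP xx xy.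
Qed.

(** An element of the union is coded by the pair of the code of its index and of
    its code in the corresponding member; each index contributes a set of such
    pairs, and replacement and union collect them. *)
Lemma small_bigcup T U (A : set T) (B : T -> set U) : small A ->
  (forall t, A t -> small (B t)) -> small (\bigcup_(t in A) B t).
Proof.
move=> sA sB; have [a /card_le_funP[c _ c_inj]] := sA.
have code t : exists d : U -> V, A t ->
    forall u v, B t u -> B t v -> d u = d v -> u = v.
  have [At|nAt] := pselect (A t); last by exists (fun _ => point).
  by have [b /card_le_funP[d _ d_inj]] := sB t At; exists d.
have [d d_inj] := choice code.
pose W t := setof ((fun u => opair (c t) (d t u)) @` B t).
have [w wP] := zfc_union (setof (W @` A)).
exists w; apply/card_le_relP.
exists (fun u z => exists t, [/\ A t, B t u & z = opair (c t) (d t u)]).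
split=> [u [t At Bu]|u u' z _ _ [t [At Bu ->]] [t' [At' Bu' /opair_inj[ct]]]].
  exists (opair (c t) (d t u)); last by exists t.
  apply/wP; exists (W t); split; first by apply/(small_setof _ sA); exists t.
  by apply/(small_setof _ (sB _ At)); exists u.
by have tt' := c_inj _ _ At At' ct; subst t'; exact: d_inj.
Qed.

Lemma small_setX T U (A : set T) (B : set U) :
  small A -> small B -> small (A `*` B).
Proof.
move=> sA sB.
apply: (@small_sub _ _ (\bigcup_(t in A) [set p | p.1 = t /\ B p.2])).
  by move=> [t u] [/= At Bu]; exists t.
apply: small_bigcup => // t _; apply: small_le sB.
by apply: (@card_le_inj _ _ _ _ snd) => [[x y] []|[x y] [x' y'] /= [-> _] [-> _] ->].
Qed.

(** Codes of elements turn a subset of A into an element of a power set. *)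
Lemma small_power T (A : set T) : small A -> small [set S | S `<=` A].
Proof.
move=> sA; have [a /card_le_funP[c ca c_inj]] := sA.
have [p pP] := zfc_powerset a.
have cP S : S `<=` A -> forall y, y \inV setof (c @` S) <-> (c @` S) y.
  by move=> SA; apply: small_setof; exact: small_sub SA sA.
exists p; apply: (@card_le_inj _ _ _ _ (fun S => setof (c @` S))).
  by move=> S SA; apply/pP => z /(cP S SA)[t /SA At <-]; exact: ca.
move=> S S' SA S'A e.
apply/seteqP; split=> t St.
  have /(cP S SA) : (c @` S) (c t) by exists t.
  by rewrite e => /(cP S' S'A)[t' St' /c_inj <-]//; [exact: S'A|exact: SA].
have /(cP S' S'A) : (c @` S') (c t) by exists t.
by rewrite -e => /(cP S SA)[t' St' /c_inj <-]//; [exact: SA|exact: S'A].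
Qed.

Lemma small_fun T U (B : set U) : small [set: T] -> small B ->
  small [set f : T -> U | forall t, B (f t)].
Proof.
move=> sT sB; apply: small_le (small_power (small_setX sT sB)).
apply: (@card_le_inj _ _ _ _ (fun f => [set p | p.2 = f p.1])) => [f fB [t u] /= ->//|].
move=> f g _ _ fg; apply/funext => t.
by have : [set p | p.2 = f p.1] (t, f t) by []; rewrite fg.
Qed.

Lemma mem_irr x : ~ x \inV x.
Proof.
move=> xx; have [|y [/upairP[]->]] := @zfc_foundation V (upair x x).
- by exists x; apply/upairP; left.
- by move=> /(_ x)[]//; apply/upairP; left.
- by move=> /(_ x)[]//; apply/upairP; left.
Qed.

(** The von Neumann numerals lie in every inductive set. *)
Lemma small_nat : small [set: nat].
Proof.
have [w [[e [ew _]] w_succ]] := @zfc_infinity V.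
have succ x : exists y, x \inV w ->
    y \inV w /\ forall z, z \inV y <-> z \inV x \/ z = x.
  have [xw|nxw] := pselect (x \inV w); last by exists x.
  by have [y yP] := w_succ x xw; exists y.
have [S SP] := choice succ.
have numw n : iter n S e \inV w by elim: n => // n /SP[].
have num_lt m n : (m < n)%N -> iter m S e \inV iter n S e.
  elim: n => // n IH; rewrite ltnS leq_eqVlt => /predU1P[->|/IH mn].
    by apply/((SP _ (numw n)).2); right.
  by apply/((SP _ (numw n)).2); left.
exists w; apply: (@card_le_inj _ _ _ _ (fun n => iter n S e)) => [n _|m n _ _ mn].
  exact: numw.
by case: (ltngtP m n) => // /num_lt; rewrite mn => /mem_irr.
Qed.

(** Foundation speaks of sets only, so it is applied to the range of the
    descending sequence, which is a set by replacement. *)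
Lemma mem_no_descent (s : nat -> V) : ~ forall n, s n.+1 \inV s n.
Proof.
move=> sP; have rangeP := small_setof s small_nat.
have [|y [/rangeP[n _ <-] ymin]] := @zfc_foundation V (setof (range s)).
  by exists (s 0); apply/rangeP; exists 0.
by apply: (ymin (s n.+1)) => //; apply/rangeP; exists n.+1.
Qed.

Lemma mem_wf : well_founded (@Defs.mem V).
Proof. by apply: wf_no_descent => s; exact: mem_no_descent. Qed.

Lemma small_setU1 x a : small (x |` elts a).
Proof.
have [u uP] := zfc_union (upair a (upair x x)).
exists u; apply: subset_card_le => z [->|za]; apply/uP.
  by exists (upair x x); rewrite !upairP; split; [right|left].
by exists a; rewrite upairP; split=> //; left.
Qed.

End SetFormation.

(** * The Mostowski collapse *)

Section Collapse.
Variable V : zfcType.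

(** The predecessors of a point need not form a small class: it suffices that a
    small class represents them up to having the same predecessors, since points
    with the same predecessors have the same image.  This is what happens for
    membership modulo an ultrafilter. *)
Lemma mostowski T (R : T -> T -> Prop) : well_founded R ->
  (forall t, exists2 D : set T, small V D & forall s, R s t ->
     exists2 s', D s' & R s' t /\ forall r, R r s <-> R r s') ->
  exists pi : T -> V, forall t x, x \inV pi t <-> exists2 s, R s t & pi s = x.
Proof.
move=> Rwf Rsmall.
pose F t (rec : forall s, R s t -> V) : V :=
  setof (fun x => exists s (Rst : R s t), rec s Rst = x).
pose pi := Fix Rwf (fun _ => V) F.
have piE t : pi t = setof (fun x => exists2 s, R s t & pi s = x).
  rewrite /pi Fix_eq => [|{}t f g fg]; last first.
    by congr (F t _); apply: functional_extensionality_dep => s; apply/funext.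
  congr setof; apply/funext => x; apply/propext.
  by split=> [[s [Rst]]|[s Rst]]; exists s.
have pi_ext s s' : (forall r, R r s <-> R r s') -> pi s = pi s'.
  move=> ss'; rewrite !piE; congr setof; apply/funext => x; apply/propext.
  by split=> -[r /ss' Rr <-]; exists r.
exists pi => t; rewrite {1}piE; have [D sD DP] := Rsmall t.
apply: (@setofP _ (setof (pi @` D))) => x [s /DP[s' Ds' [_ /pi_ext ->]] <-].
by apply/(small_setof _ sD); exists s'.
Qed.

End Collapse.

(** * Ordinals *)

Section Ordinals.
Variable V : zfcType.
Implicit Types (a b c x y z : V).

Lemma mem_asym x y : x \inV y -> ~ y \inV x.
Proof.
elim/(well_founded_ind (@mem_wf V)): x y => x IH y xy yx.
exact: (IH y yx x yx).
Qed.

Lemma mem_acyclic3 x y z : x \inV y -> y \inV z -> ~ z \inV x.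
Proof.
elim/(well_founded_ind (@mem_wf V)): x y z => x IH y z xy yz zx.
exact: (IH z zx x y).
Qed.

Lemma ord_elt a x : ordinal_set a -> x \inV a -> ordinal_set x.
Proof.
move=> [a_tr a_lin] xa; split=> [y z yx zy|y z yx zx]; last first.
  by apply: a_lin; [exact: a_tr yx|exact: a_tr zx].
have ya := a_tr _ _ xa yx; have za := a_tr _ _ ya zy.
have [//|zx|xz] := a_lin _ _ za xa; first by subst z; case: (mem_asym zy).
by case: (mem_acyclic3 zy yx).
Qed.

Lemma ord_total a b : ordinal_set a -> ordinal_set b ->
  [\/ a \inV b, a = b | b \inV a].
Proof.
elim/(well_founded_ind (@mem_wf V)): a b => a IHa b.
elim/(well_founded_ind (@mem_wf V)): b => b IHb oa ob.
have [?|nba] := pselect (b \inV a); first by constructor 3.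
have [?|nab] := pselect (a \inV b); first by constructor 1.
constructor 2; apply: setext => z; split=> [za|zb].
  have [//|zb|bz] := IHa z za b (ord_elt oa za) ob; first by subst z.
  by case: nba; apply: oa.1 bz.
have [az|az|//] := IHb z zb oa (ord_elt ob zb); last by subst z.
by case: nab; apply: ob.1 az.
Qed.

Lemma ord_notin a b : ordinal_set a -> ordinal_set b -> ~ a \inV b -> b <=V a.
Proof. by move=> oa ob; have [//|->|] := ord_total oa ob; [right|left]. Qed.

Lemma leV_notin a b : a <=V b -> ~ b \inV a.
Proof. by move=> [/mem_asym//|->]; exact: mem_irr. Qed.

Lemma leV_sub a b : ordinal_set b -> a <=V b -> elts a `<=` elts b.
Proof. by move=> [b_tr _] [ab|->] // x; exact: b_tr. Qed.

Lemma leV_trans a b c : ordinal_set c -> a <=V b -> b <=V c -> a <=V c.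
Proof. by move=> oc [ab|->] // /(leV_sub oc)/(_ _ ab) ac; left. Qed.

Lemma leV_mem_trans a b c : ordinal_set c -> a <=V b -> b \inV c -> a \inV c.
Proof. by move=> [c_tr _] [ab /c_tr|->] //; apply. Qed.

Lemma leastP (P : set V) : P !=set0 -> (forall a, P a -> ordinal_set a) ->
  P (least P) /\ forall a, P a -> least P <=V a.
Proof.
move=> [a0 Pa0] Pord; apply: (@getPex _ [set c | P c /\ forall d, P d -> leV c d]).
elim/(well_founded_ind (@mem_wf V)): a0 Pa0 => a IH Pa.
have [[b [Pb ba]]|nb] := pselect (exists b, P b /\ b \inV a); first exact: IH Pb.
exists a; split=> // d Pd; apply: ord_notin; [exact: Pord..|].
by move=> da; apply: nb; exists d.
Qed.

(** On a total order the collapse is injective and its range is an ordinal.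
    Well-foundedness and trichotomy force R to be transitive. *)
Lemma order_type T (R : T -> T -> Prop) (A : set T) : small V A ->
  well_founded R -> (forall s t, R s t -> A s /\ A t) ->
  (forall s t, A s -> A t -> [\/ R s t, s = t | R t s]) ->
  exists (pi : T -> V) (o : V), [/\ ordinal_set o,
    forall x, x \inV o <-> (pi @` A) x,
    forall s t, A s -> A t -> pi s = pi t -> s = t &
    forall t x, x \inV pi t <-> exists2 s, R s t & pi s = x].
Proof.
move=> sA Rwf RA Rlin; have [|pi piP] := @mostowski V T R Rwf.
  by move=> t; exists A => // s Rst; exists s => //; exact: (RA _ _ Rst).1.
have oP := small_setof pi sA.
exists pi, (setof (pi @` A)); split=> //.
  split=> [x y /oP[t At <-] /piP[s /RA[As _] <-]|x y /oP[s As <-] /oP[t At <-]].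
    by apply/oP; exists s.
  have [st|->|ts] := Rlin _ _ As At; [constructor 1|constructor 2|constructor 3] => //.
    by apply/piP; exists s.
  by apply/piP; exists t.
move=> s t As At pist; have [st|//|ts] := Rlin _ _ As At.
  by case: (@mem_irr _ (pi t)); apply/piP; exists s.
by case: (@mem_irr _ (pi t)); rewrite -{2}pist; apply/piP; exists t.
Qed.

(** The order type of a well-order of the type, restricted to A. *)
Lemma small_ordinal T (A : set T) : small V A ->
  exists2 o : V, ordinal_set o & elts o #= A.
Proof.
move=> sA; have [W Wwo] := well_ordering_principle {classic T}.
have Wmin (P : set T) : P !=set0 -> exists2 m, P m & forall t, P t -> W m t.
  move=> [t Pt]; have [|m [[mP m_min] _]] := Wwo [pred t | `[< P t >]].
    by exists t; apply/asboolP.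
  by exists m; [exact/asboolP|move=> s Ps; apply: m_min; apply/asboolP].
have Wrefl s : W s s by have [|m -> /(_ s)] := Wmin [set s]; [exists s|exact].
have Wanti s t : W s t -> W t s -> s = t.
  move=> Wst Wts; have [|m [_ m_uniq]] := Wwo [pred r | `[< r = s \/ r = t >]].
    by exists s; apply/asboolP; left.
  rewrite -(m_uniq s) ?(m_uniq t)//; split.
  - by apply/asboolP; right.
  - by move=> r /asboolP[] ->.
  - by apply/asboolP; left.
  - by move=> r /asboolP[] ->.
pose R s t := [/\ A s, A t, W s t & s <> t].
have Rwf : well_founded R.
  move=> t; apply: contrapT => nAt.
  have [|m nAm m_min] := Wmin [set t | ~ Acc R t]; first by exists t.
  apply: nAm; split=> s [_ _ Wsm sm]; apply: contrapT => /m_min Wms; apply: sm.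
  exact: Wanti.
have [||pi [o [oo oP pi_inj _]]] := order_type sA Rwf.
- by move=> s t [].
- move=> s t As At; have [st|nst] := pselect (s = t); first by constructor 2.
  have [|m [->|->] m_min] := Wmin [set s; t]; first by exists s; left.
    by constructor 1; split=> //; apply: m_min; right.
  by constructor 3; split=> //; [apply: m_min; left|exact/nesym].
exists o => //; have -> : elts o = pi @` A by apply/seteqP; split=> x /oP.
by apply: inj_card_eq => s t; rewrite !inE; exact: pi_inj.
Qed.

End Ordinals.

(** * Cardinals *)

Section Cardinals.
Variable V : zfcType.
Implicit Types (a b c d x y z f : V).

Lemma maps_toE f x y : maps_to f x y <-> opair x y \inV f.
Proof.
split=> [[p pf /is_opairE <-//]|xyf].
by exists (opair x y) => //; apply/is_opairE.
Qed.

Lemma bijection_from_toE f a b : bijection_from_to f a b <->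
  [/\ forall p, p \inV f ->
        exists x y, [/\ x \inV a, y \inV b & p = opair x y],
      forall x, x \inV a -> exists! y, opair x y \inV f &
      forall y, y \inV b -> exists! x, opair x y \inV f].
Proof.
rewrite /bijection_from_to.
have mE : maps_to f = fun x y => opair x y \inV f.
  by apply/funext => x; apply/funext => y; apply/propext/maps_toE.
have oE : @is_opair V = fun p x y => p = opair x y.
  do 3 apply/funext => ?; exact/propext/is_opairE.
by rewrite mE oE.
Qed.

(** The graph of a function between sets of V is a set by replacement, so that
    the cardinals of V are recognized by equipotence of subsets of types. *)
Lemma card_eq_bijection a b :
  elts a #= elts b <-> exists f, bijection_from_to f a b.
Proof.
split=> [/card_eq_funP[F [Fab F_inj F_surj]]|[f /bijection_from_toE[fab f_fun f_inv]]].
  have sa := small_elts a; pose G x := opair x (F x).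
  exists (setof (G @` elts a)); apply/bijection_from_toE; split.
  - by move=> p /(small_setof G sa)[x xa <-]; exists x, (F x); split=> //; exact: Fab.
  - move=> x xa; exists (F x); split; first by apply/(small_setof G sa); exists x.
    by move=> y /(small_setof G sa)[x' _ /opair_inj[<-]].
  - move=> y /F_surj[x xa <-]; exists x; split.
      by apply/(small_setof G sa); exists x.
    by move=> x' /(small_setof G sa)[z za /opair_inj[<- /F_inj]] ->.
apply/card_eqPle; split; apply/card_le_relP.
  exists (fun x y => opair x y \inV f); split=> [x xa|x x' y xa xa' xy x'y].
    have [y [xy _]] := f_fun x xa; exists y => //.
    by have [x' [y' [_ yb /opair_inj[_ ->]]]] := fab _ xy.
  have [_ [y' [_ yb /opair_inj[_ yy']]]] := fab _ xy; rewrite -yy' in yb.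
  by have [z [_ zP]] := f_inv y yb; rewrite -(zP x)// -(zP x').
exists (fun y x => opair x y \inV f); split=> [y yb|y y' x yb yb' xy xy'].
  have [x [xy _]] := f_inv y yb; exists x => //.
  by have [x' [y' [xa _ /opair_inj[->]]]] := fab _ xy.
have [x' [_ [xa _ /opair_inj[xx' _]]]] := fab _ xy; rewrite -xx' in xa.
by have [z [_ zP]] := f_fun x xa; rewrite -(zP y)// -(zP y').
Qed.

Lemma cardinalVE c : cardinalV c <->
  ordinal_set c /\ forall b, b \inV c -> ~ (elts b #= elts c).
Proof.
split=> [[_ oc cP]|[oc cP]]; split=> // b.
  by move=> bc /card_eq_bijection[f]; apply: cP.
by move=> f bc _ fP; apply: (cP b) => //; apply/card_eq_bijection; exists f.
Qed.

Lemma cardinal_ord c : cardinalV c -> ordinal_set c.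
Proof. by case. Qed.

(** A cardinal above d would be equipotent with its element d, by the theorem of
    Cantor and Bernstein. *)
Lemma card_le_leV c d : cardinalV c -> ordinal_set d ->
  elts c #<= elts d -> c <=V d.
Proof.
move=> /cardinalVE[oc cP] od cd; apply: ord_notin => // dc.
apply: (cP d) => //; apply/card_eqPle; split=> //.
by apply/subset_card_le/leV_sub => //; left.
Qed.

Lemma leV_card_le c d : ordinal_set d -> c <=V d -> elts c #<= elts d.
Proof. by move=> od cd; apply/subset_card_le/leV_sub. Qed.

Lemma cardinal_ofP T (A : set T) : small V A ->
  cardinalV (cardinal_of A : V) /\ elts (cardinal_of A : V) #= A.
Proof.
move=> sA; apply: (@getPex _ [set c : V | cardinalV c /\ elts c #= A]).
have [o oo oA] := @small_ordinal V T A sA.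
have [||[oc cA] c_min] := @leastP V [set o | ordinal_set o /\ elts o #= A].
- by exists o.
- by move=> a [].
exists (least [set o | ordinal_set o /\ elts o #= A]); split=> //.
apply/cardinalVE; split=> // b bc bA.
apply: (@leV_notin V _ _ _ bc); apply: c_min; split; first exact: ord_elt bc.
exact: card_eq_trans bA cA.
Qed.

Lemma cardinal_of_eq T U (A : set T) (B : set U) :
  A #= B -> cardinal_of A = cardinal_of B :> V.
Proof.
move=> AB; congr (get _); apply/funext => c; apply/propext.
by rewrite /mkset (card_eqr AB).
Qed.

Lemma cardinal_of_leV T (A : set T) a : small V A -> ordinal_set a ->
  A #<= elts a -> cardinal_of A <=V a.
Proof.
move=> sA oa Aa; have [cA /card_eqPle[Ale _]] := cardinal_ofP sA.
by apply: card_le_leV => //; exact: card_le_trans Aa.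
Qed.

Lemma cardinal_of_le T U (A : set T) (B : set U) : small V B -> A #<= B ->
  (cardinal_of A : V) <=V cardinal_of B.
Proof.
move=> sB AB; have [cB /card_eqPle[_ Ble]] := cardinal_ofP sB.
by apply: cardinal_of_leV; [exact: small_le AB sB|case: cB|exact: card_le_trans Ble].
Qed.

Lemma small_card_total T U (A : set T) (B : set U) : small V A -> small V B ->
  A #<= B \/ B #<= A.
Proof.
move=> /cardinal_ofP[[_ oA _] /card_eqPle[lA gA]].
move=> /cardinal_ofP[[_ oB _] /card_eqPle[lB gB]].
have le_of a b : ordinal_set b -> a \inV b -> elts a #<= elts b.
  by move=> ob ab; apply: leV_card_le => //; left.
have [/le_of|e|/le_of] := ord_total oA oB.
- by move=> /(_ oB) AB; left; apply: card_le_trans gA _; apply: card_le_trans lB.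
- by left; apply: card_le_trans gA _; rewrite e.
- by move=> /(_ oA) BA; right; apply: card_le_trans gB _; apply: card_le_trans lA.
Qed.

Definition to_El a x (xa : x \inV a) : El a := exist _ x xa.

Lemma elt_valP a (x : El a) : elt_val x \inV a.
Proof. exact: (proj2_sig x). Qed.

Lemma elt_val_inj a (x y : El a) : elt_val x = elt_val y -> x = y.
Proof. by case: x y => [x xa] [y ya] /= xy; exact: eq_exist. Qed.

Lemma card_El a : [set: El a] #= elts a.
Proof.
have -> : elts a = @elt_val V a @` setT.
  apply/seteqP; split=> [x xa|_ [[x xa] _ <-]//].
  by exists (to_El xa).
by rewrite card_eq_sym; apply: inj_card_eq => x y _ _; exact: elt_val_inj.
Qed.

Lemma small_El a : small V [set: El a].
Proof. by exists a; have /card_eqPle[] := card_El a. Qed.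

Lemma card_le_bool_fun T U :
  [set: T] #<= [set: U] -> [set: T -> bool] #<= [set: U -> bool].
Proof.
move=> /card_le_relP[R [Rex Rinj]].
pose push (p : T -> bool) u := `[< exists2 t, R t u & p t >].
apply: (@card_le_inj _ _ _ _ push) => // p q _ _ pq.
apply/funext => t; have [u _ Rtu] := Rex t I; have := congr1 (@^~ u) pq.
have pE (r : T -> bool) : `[< exists2 t, R t u & r t >] = r t.
  apply/asboolP/idP => [[t' Rt'u]|rt]; last by exists t.
  by rewrite (Rinj t t' u).
by rewrite /push /= !pE.
Qed.

Lemma small_bool_fun T : small V [set: T] -> small V [set: T -> bool].
Proof.
move=> sT; apply: small_le (small_power sT).
apply: (@card_le_inj _ _ _ _ (fun (p : T -> bool) => [set t | p t])) => // p q _ _ pq.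
apply/funext => t; apply/idP/idP => pt.
  by have : [set t | p t] t by []; rewrite pq.
by have : [set t | q t] t by []; rewrite -pq.
Qed.

Lemma pow2P a : cardinalV (pow2 a) /\ elts (pow2 a) #= [set: El a -> bool].
Proof. exact/cardinal_ofP/small_bool_fun/small_El. Qed.

(** Otherwise 2^|a| <= a, against Cantor's theorem. *)
Lemma mem_pow2_cardinal a : ordinal_set a ->
  a \inV pow2 (cardinal_of (elts a)).
Proof.
move=> oa; set l := cardinal_of _.
have [[_ op _] /card_eqPle[_ pge]] := pow2P l.
have [//|e|pa] := ord_total oa op.
all: have {}pa : pow2 l <=V a by [right|left].
all: have [_ /card_eqPle[lge la]] := cardinal_ofP (small_elts a).
all: have /card_eqPle[_ la'] := card_El l.
all: case: (@card_bool_fun_gt (El l)); apply: card_le_trans pge _.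
all: apply: card_le_trans (leV_card_le oa pa) _.
all: by apply: card_le_trans la la'.
Qed.

Lemma succ_cardP a : ordinal_set a ->
  [/\ cardinalV (succ_card a), a \inV succ_card a &
    forall c, cardinalV c -> a \inV c -> succ_card a <=V c].
Proof.
move=> oa; have [||[cs as_] s_min] := @leastP V [set c | cardinalV c /\ a \inV c].
- exists (pow2 (cardinal_of (elts a))); split; last exact: mem_pow2_cardinal.
  by case: (pow2P (cardinal_of (elts a))).
- by move=> c [[]].
by split=> // c cc ac; apply: s_min.
Qed.

End Cardinals.

(** * The square of an infinite cardinal *)

Section Hessenberg.
Variable V : zfcType.
Implicit Types (a b c d x y z f : V) (p q : V * V).

Definition maxV p : V := if `[< p.1 \inV p.2 >] then p.2 else p.1.

(** Goedel's well-order of pairs: by maximum, then lexicographically.  Its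
    initial segments lie in squares of smaller ordinals. *)
Definition godel_lt p q : Prop := maxV p \inV maxV q \/
  maxV p = maxV q /\ (p.1 \inV q.1 \/ p.1 = q.1 /\ p.2 \inV q.2).

Lemma godel_wf : well_founded godel_lt.
Proof.
suff AccP m x y : maxV (x, y) = m -> Acc godel_lt (x, y) by move=> [x y]; exact: AccP.
elim/(well_founded_ind (@mem_wf V)): m x y => m IHm x.
elim/(well_founded_ind (@mem_wf V)): x => x IHx y.
elim/(well_founded_ind (@mem_wf V)): y => y IHy mE.
constructor=> -[x' y'] [|[m'E [/= x'x|/= [x'x y'y]]]].
- by rewrite mE => /IHm; apply.
- by apply: IHx => //; rewrite m'E.
- by rewrite x'x; apply: IHy => //; rewrite -x'x m'E.
Qed.

Lemma godel_total a p q : ordinal_set a ->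
  (elts a `*` elts a) p -> (elts a `*` elts a) q ->
  [\/ godel_lt p q, p = q | godel_lt q p].
Proof.
move=> oa [/= p1 p2] [/= q1 q2]; have [_ lin] := oa.
have ma r : (elts a `*` elts a) r -> maxV r \inV a.
  by move=> [r1 r2]; rewrite /maxV; case: ifP.
have [pq|mpq|qp] := lin _ _ (ma p (conj p1 p2)) (ma q (conj q1 q2)).
- by constructor 1; left.
- have [pq|pq1|qp] := lin _ _ p1 q1.
  + by constructor 1; right; split=> //; left.
  + have [pq|pq2|qp] := lin _ _ p2 q2.
    * by constructor 1; right; split=> //; right.
    * by constructor 2; case: p q pq1 pq2 {p1 p2 q1 q2 mpq} => [? ?] [? ?] /= -> ->.
    * by constructor 3; right; split=> //; right.
  + by constructor 3; right; split=> //; left.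
- by constructor 3; left.
Qed.

Lemma maxV_bound a p : ordinal_set a -> (elts a `*` elts a) p ->
  p.1 <=V maxV p /\ p.2 <=V maxV p.
Proof.
move=> oa [/= p1 p2]; rewrite /maxV; case: asboolP => [p12|np12].
  by split; [left|right].
have [//|->|p21] := oa.2 _ _ p1 p2; first by split; right.
by split; [right|left].
Qed.

Lemma godel_lt_bound a p q : ordinal_set a -> (elts a `*` elts a) p ->
  (elts a `*` elts a) q -> godel_lt p q ->
  ((maxV q |` elts (maxV q)) `*` (maxV q |` elts (maxV q))) p.
Proof.
move=> oa ap aq pq; have mqa : maxV q \inV a.
  by move: aq => [? ?]; rewrite /maxV; case: ifP.
have om := ord_elt oa mqa; have [p1 p2] := maxV_bound oa ap.
have mpq : maxV p <=V maxV q by case: pq => [|[-> _]]; [left|right].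
split=> /=.
  by have [|->] := leV_trans om p1 mpq; [right|left].
by have [|->] := leV_trans om p2 mpq; [right|left].
Qed.

(** Otherwise the order type of c * c exceeds c, so that c is equipotent with a
    proper initial segment of c * c.  That segment lies in the square of the
    successor s of some m in c, and s * s has the size of m * m, hence of m by
    induction, which is smaller than c. *)
Lemma card_square_cardinal c : cardinalV c -> infinite_set (elts c) ->
  elts c `*` elts c #<= elts c.
Proof.
elim/(well_founded_ind (@mem_wf V)): c => c IH cc infc; have [_ oc _] := cc.
pose R p q := [/\ (elts c `*` elts c) p, (elts c `*` elts c) q & godel_lt p q].
have Rwf : well_founded R.
  move=> p; elim/(well_founded_ind godel_wf): p => p IHp.
  by constructor=> q [_ _ /IHp].
have scc : small V (elts c `*` elts c) by apply: small_setX; exact: small_elts.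
have [||pi [g [og gP pi_inj piP]]] := order_type scc Rwf.
- by move=> p q [].
- move=> p q cp cq; have [pq|->|qp] := godel_total oc cp cq.
  + by constructor 1.
  + by constructor 2.
  + by constructor 3.
have ccg : elts c `*` elts c #<= elts g.
  by apply: (@card_le_inj _ _ _ _ pi) => // p cp; apply/gP; exists p.
have [cg|gc] := pselect (c \inV g); last first.
  by apply: card_le_trans ccg _; apply: leV_card_le => //; exact: ord_notin.
have [q cq piq] := (gP c).1 cg.
pose m := maxV q; pose s := m |` elts m.
have mc : m \inV c by case: cq => ? ?; rewrite /m /maxV; case: ifP.
have om := ord_elt oc mc.
have cs : elts c #<= s `*` s.
  apply: (@card_le_trans _ _ _ [set p | R p q]).
    rewrite -piq; apply/card_le_relP; exists (fun x p => R p q /\ pi p = x).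
    by split=> [x /piP[p Rpq <-]|x x' p _ _ [_ <-] [_ <-]]//; exists p.
  by apply: subset_card_le => p [cp _ pq]; exact: (godel_lt_bound oc).
have infs : infinite_set s.
  by move=> fs; apply: infc; apply: card_le_finite cs _; exact: finite_setX.
have infm : infinite_set (elts m).
  by move=> fm; apply: infs; rewrite finite_setU; split.
have sm := infinite_setU1_le m infm.
have [cd /card_eqPle[dm md]] := cardinal_ofP (small_elts m).
set d := cardinal_of _ in cd dm md.
have dc : d \inV c.
  by apply: (leV_mem_trans oc) mc; apply: cardinal_of_leV => //; exact: small_elts.
have infd : infinite_set (elts d) by move=> fd; apply: infm; exact: card_le_finite fd.
have od := cardinal_ord cd.
case: (leV_notin (card_le_leV cc od _) dc).
apply: card_le_trans cs _; apply: card_le_trans (IH d dc cd infd).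
by apply: card_leX; apply: card_le_trans md.
Qed.

Lemma card_square_le T (A : set T) : small V A -> infinite_set A -> A `*` A #<= A.
Proof.
move=> /cardinal_ofP[cc /card_eqPle[ca ac]] infA.
apply: card_le_trans ca; apply: card_le_trans (card_square_cardinal cc _).
  exact: card_leX.
by move=> fc; apply: infA; exact: card_le_finite fc.
Qed.

Lemma card_le_setX_or T T' T'' (P : set T) (A : set T') (B : set T'') :
  small V A -> small V B -> infinite_set P -> P #<= A `*` B ->
  P #<= A \/ P #<= B.
Proof.
move=> sA sB infP PAB.
have sub U (C : set U) : small V C -> P #<= C `*` C -> P #<= C.
  move=> sC PC; apply: (card_le_trans PC); apply: card_square_le => // fC.
  by apply: infP; apply: (card_le_finite PC); exact: finite_setX.
have [AB|BA] := small_card_total sA sB; [right|left]; apply: sub => //.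
  by apply: card_le_trans PAB _; exact: card_leX.
by apply: card_le_trans PAB _; exact: card_leX.
Qed.

End Hessenberg.

(** * The ultrapower *)

Section Ultrapower.
Variables (V : zfcType) (kappa : V).
Local Notation K := (El kappa).
Variable U : set_system K.
Hypotheses (U_ultra : UltraFilter U) (U_sigma : sigma_complete U).
Implicit Types (f g k e : K -> V) (a b c x y : V).

Local Notation cls := (collapse U).

Lemma ultra_or (P Q : set K) : U [set al | P al \/ Q al] -> U P \/ U Q.
Proof.
move=> UPQ; have [|UnP] := in_ultra_setVsetC P U_ultra; [by left|right].
by apply: filterS2 UPQ UnP => al [].
Qed.

Lemma ultra_not (P : set K) : U [set al | ~ P al] <-> ~ U P.
Proof.
split=> [UnP UP|nUP]; last by have [|] := in_ultra_setVsetC P U_ultra.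
apply: (@filter_not_empty _ U _); apply: filterS2 UnP UP => al; exact.
Qed.

Lemma ultra_choice (P : K -> V -> Prop) : U [set al | exists x, P al x] ->
  exists g, U [set al | P al (g al)].
Proof.
move=> UP; exists (fun al => get (P al)).
by apply: filterS UP => al [x Px]; exact: (@getPex _ (P al) (ex_intro _ x Px)).
Qed.

(** By sigma-completeness a descending sequence of representatives descends at
    some single index. *)
Lemma ult_mem_wf : well_founded (ult_mem U).
Proof.
apply: wf_no_descent => s sP; have /filter_ex[al al_s] := U_sigma sP.
by apply: (@mem_no_descent V (s^~ al)) => n; exact: (al_s n).
Qed.

(** Modulo U, the members of f can be represented by functions g that satisfy
    g(al) \in f(al) or g(al) = point at every al, and these form a small class. *)
Lemma collapseP : is_collapse U cls.
Proof.
apply: (@getPex _ [set pi | is_collapse U pi]); apply: mostowski ult_mem_wf _ => f.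
pose B := \bigcup_al (point |` elts (f al)).
have sB : small V B.
  apply: small_bigcup (small_El kappa) _ => al _; exact: small_setU1.
exists [set g : K -> V | forall al, B (g al)]; first exact: small_fun (small_El _) sB.
move=> g gf; pose g' al := if `[< g al \inV f al >] then g al else point.
have gg' : U [set al | g al = g' al].
  by apply: filterS gf => al gf; rewrite /= /g' asboolT.
exists g'; last split.
- move=> al; exists al => //; rewrite /g'; case: asboolP => // ?; first by right.
  by left.
- by apply: filterS2 gf gg' => al /= gf <-.
- by move=> r; split=> rg; apply: filterS2 gg' rg => al /= ->.
Qed.

Lemma cls_eq f g : U [set al | f al = g al] -> cls f = cls g.
Proof.
move=> fg; apply: setext => x; rewrite !collapseP.
by split=> -[k kf <-]; exists k => //; apply: filterS2 fg kf => al /= ->.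
Qed.

(** Extensionality of the ultrapower: if f and g differ almost everywhere, then
    almost everywhere one of them, always the same, has an element outside of
    the other; its class lies in only one of the two images, by induction. *)
Lemma cls_inj f g : cls f = cls g -> U [set al | f al = g al].
Proof.
elim/(well_founded_ind ult_mem_wf): f g => f IH g fg; apply: contrapT => /ultra_not fNg.
have : U ([set al | exists x, x \inV f al /\ ~ x \inV g al] `|`
          [set al | exists x, x \inV g al /\ ~ x \inV f al]).
  apply: filterS fNg => al /= fNg; apply: contrapT => /not_orP[nfg ngf].
  by apply: fNg; apply: setext => x; split=> xf; apply: contrapT => xg;
    [apply: nfg|apply: ngf]; exists x.
have disj (P Q R : set K) : U P -> U Q -> U R -> ~ (forall al, P al -> Q al -> ~ R al).
  move=> UP UQ UR PQR; apply: (@filter_not_empty _ U _).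
  exact: filterS3 UP UQ UR.
move=> /ultra_or[|] /ultra_choice[k kP].
  have kf : ult_mem U k f by apply: filterS kP => al [].
  have /collapseP[k' k'g kk'] : cls k \inV cls g.
    by rewrite -fg; apply/collapseP; exists k.
  by apply: (disj _ _ _ kP k'g (IH k kf k' (esym kk'))) => al /= [_ +] + e; rewrite e.
have kg : ult_mem U k g by apply: filterS kP => al [].
have /collapseP[k' k'f kk'] : cls k \inV cls f.
  by rewrite fg; apply/collapseP; exists k.
by apply: (disj _ _ _ kP k'f (IH k' k'f k kk')) => al /= [_ +] + e; rewrite e.
Qed.

Lemma cls_mem f g : cls f \inV cls g <-> U [set al | f al \inV g al].
Proof.
split=> [/collapseP[k kg /cls_inj kf]|fg]; last by apply/collapseP; exists f.
by apply: filterS2 kf kg => al /= ->.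
Qed.

Lemma cls_upair f g :
  cls (fun al => upair (f al) (g al)) = upair (cls f) (cls g).
Proof.
apply: setext => x; rewrite upairP collapseP; split=> [[k kfg <-]|].
  have /ultra_or[kf|kg] : U [set al | k al = f al \/ k al = g al].
    by apply: filterS kfg => al /upairP.
  - by left; exact: cls_eq.
  - by right; exact: cls_eq.
case=> ->; [exists f|exists g] => //; apply: filterE => al; apply/upairP;
  by [left|right].
Qed.

Lemma cls_opair f g :
  cls (fun al => opair (f al) (g al)) = opair (cls f) (cls g).
Proof. by rewrite /opair -!cls_upair. Qed.

(** The collapse commutes with pairs and quantifiers over elements can be
    witnessed pointwise, so that the class of e is again a bijection. *)
Lemma cls_bijection e f g : U [set al | bijection_from_to (e al) (f al) (g al)] ->
  bijection_from_to (cls e) (cls f) (cls g).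
Proof.
move=> eP; apply/bijection_from_toE.
have e_pairs p : p \inV cls e ->
    exists x y, [/\ x \inV cls f, y \inV cls g & p = opair x y].
  move=> /collapseP[q qe <-].
  have /ultra_choice[x /ultra_choice[y xyP]] : U [set al | exists x y,
      [/\ x \inV f al, y \inV g al & q al = opair x y]].
    by apply: filterS2 eP qe => al /= /bijection_from_toE[+ _ _]; apply.
  exists (cls x), (cls y); split; try by apply/cls_mem; apply: filterS xyP => al [].
  by rewrite -cls_opair; apply: cls_eq; apply: filterS xyP => al [].
have memE (x y : K -> V) : opair (cls x) (cls y) \inV cls e <->
  U [set al | opair (x al) (y al) \inV e al] by rewrite -cls_opair cls_mem.
split=> //.
  move=> _ /collapseP[x xf <-].
  have /ultra_choice[y xyP] : U [set al | exists y, opair (x al) y \inV e al /\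
      forall z, opair (x al) z \inV e al -> y = z].
    apply: filterS2 eP xf => al /= /bijection_from_toE[_ + _] xf.
    by move=> /(_ _ xf)[y [? ?]]; exists y.
  exists (cls y); split=> [|z xze]; first by apply/memE; apply: filterS xyP => al [].
  have [_ [z' [_ + /opair_inj[_ zz']]]] := e_pairs _ xze; rewrite -zz'.
  move=> /collapseP[w _ wz]; rewrite -wz in xze *; apply: cls_eq.
  by move/memE: xze; apply: filterS2 xyP => al [_]; apply.
move=> _ /collapseP[y yg <-].
have /ultra_choice[x xyP] : U [set al | exists x, opair x (y al) \inV e al /\
    forall z, opair z (y al) \inV e al -> x = z].
  apply: filterS2 eP yg => al /= /bijection_from_toE[_ _ +] yg.
  by move=> /(_ _ yg)[x [? ?]]; exists x.
exists (cls x); split=> [|z zye]; first by apply/memE; apply: filterS xyP => al [].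
have [z' [_ [+ _ /opair_inj[zz' _]]]] := e_pairs _ zye; rewrite -zz'.
move=> /collapseP[w _ wz]; rewrite -wz in zye *; apply: cls_eq.
by move/memE: zye; apply: filterS2 xyP => al [_]; apply.
Qed.

Lemma cls_ordinal f : (forall al, ordinal_set (f al)) -> ordinal_set (cls f).
Proof.
move=> of_; split=> [_ y /collapseP[g gf <-] /collapseP[k kg <-]|].
  by apply/cls_mem; apply: filterS2 gf kg => al /= gf; apply: (of_ al).1.
move=> _ _ /collapseP[g gf <-] /collapseP[k kf <-].
have : U ([set al | g al \inV k al] `|`
          ([set al | g al = k al] `|` [set al | k al \inV g al])).
  apply: filterS2 gf kf => al /= gf kf.
  by have [] := (of_ al).2 _ _ gf kf => ?; [left|right; left|right; right].
by move=> /ultra_or[/cls_mem|/ultra_or[/cls_eq|/cls_mem]] ?;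
  [constructor 1|constructor 2|constructor 3].
Qed.

(** By induction a is at most the class of the constant function a: if the class
    b of that function were an element of a, then b would be at most the class
    of the constant function b, which is an element of b. *)
Lemma ordinal_ultrapower a : ordinal_set a -> ultrapower U a.
Proof.
move=> oa; have const_ge : a <=V cls (fun _ => a).
  elim/(well_founded_ind (@mem_wf V)): a oa => a IH oa.
  apply: ord_notin => //; first exact: cls_ordinal.
  set b := cls _ => ba; have ob := ord_elt oa ba.
  apply: (leV_notin (IH b ba ob)); apply/cls_mem; exact: filterE.
case: const_ge => [/collapseP[g _ <-]|->]; first by exists g.
by exists (fun _ => a).
Qed.

End Ultrapower.

(** The cardinal of b is below the successor cardinal, hence at most a. *)
Lemma succ_card_equinumerous (V : zfcType) (a b : V) : ordinal_set a ->
  a \inV b -> b \inV succ_card a -> elts a #= elts b.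
Proof.
move=> oa ab bs; have [cs _ s_min] := succ_cardP oa; have os := cardinal_ord cs.
have ob := ord_elt os bs.
have [cc /card_eqPle[_ bc]] := cardinal_ofP (small_elts b).
apply/card_eqPle; split; first by apply: leV_card_le => //; left.
apply: card_le_trans bc _; apply: leV_card_le => //.
apply: ord_notin => //; first exact: cardinal_ord cc.
move=> /(s_min _ cc) sc; apply: (leV_notin sc).
by apply: (leV_mem_trans os) bs; apply: cardinal_of_leV => //; exact: small_elts.
Qed.

(** * Functions and slaloms on an inaccessible cardinal *)

Section Inaccessible.
Variables (V : zfcType) (kappa : V).
Local Notation K := (El kappa).
Hypothesis kappa_inaccessible : inaccessible kappa.

Lemma inaccessible_ordinal : ordinal_set kappa.
Proof. by case: kappa_inaccessible => -[]. Qed.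

Lemma El_ordinal (al : K) : ordinal_set (elt_val al).
Proof. by case: al => x xk; exact: ord_elt inaccessible_ordinal xk. Qed.

Lemma pow2_inaccessible a : a \inV kappa ->
  pow2 (cardinal_of (elts a)) \inV kappa.
Proof.
move=> ak; have ok := inaccessible_ordinal; have oa := ord_elt ok ak.
have sa := small_elts a; have [ca _] := cardinal_ofP sa.
case: kappa_inaccessible => _ _ _; apply=> //.
by apply: (leV_mem_trans ok _ ak); exact: cardinal_of_leV.
Qed.

Lemma succ_card_inaccessible a : a \inV kappa -> succ_card a \inV kappa.
Proof.
move=> ak; have ok := inaccessible_ordinal; have oa := ord_elt ok ak.
apply: (leV_mem_trans ok) (pow2_inaccessible ak).
have [_ _] := succ_cardP oa; apply; last exact: mem_pow2_cardinal.
exact: (pow2P _).1.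
Qed.

Lemma bounded_not_above (b : K) :
  bounded_ideal [set al : K | ~ elt_val b \inV elt_val al].
Proof.
case: b => b bk /=; have ok := inaccessible_ordinal; have ob := ord_elt ok bk.
exists (to_El (pow2_inaccessible bk)) => al /= nbal.
have op := ord_elt ok (pow2_inaccessible bk).
apply: (leV_mem_trans op) (mem_pow2_cardinal ob).
by apply: ord_notin => //; exact: El_ordinal.
Qed.

Lemma infinite_El : infinite_set [set: K].
Proof.
case: kappa_inaccessible => _ nck _ _ fK; apply: nck; apply: finite_set_countable.
by apply: card_le_finite fK; have /card_eqPle[] := card_El kappa.
Qed.

(** The value of F X at al codes the restriction of X to al.  There is room for
    the codes below kappa because kappa is a strong limit, and two distinct
    subsets have distinct restrictions to every al above a point where they
    differ. *)
Lemma eventually_different_family : exists F : (K -> bool) -> K -> K,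
  forall X Y, X <> Y -> bounded_ideal [set al | F X al = F Y al].
Proof.
have ok := inaccessible_ordinal.
have code (al : K) : exists c : (K -> bool) -> K, forall X Y, c X = c Y ->
    forall b : K, elt_val b \inV elt_val al -> X b = Y b.
  case: al => a ak /=; have oa := ord_elt ok ak.
  have incl (x : El a) : {b : K | elt_val b = elt_val x}.
    by case: x => x xa; exists (to_El (ok.1 _ _ ak xa)).
  pose restr (X : K -> bool) (x : El a) := X (sval (incl x)).
  have : [set: El a -> bool] #<= [set: K].
    have [_ /card_eqPle[_ apow]] := cardinal_ofP (small_elts a).
    have [_ /card_eqPle[_ ple]] := pow2P (cardinal_of (elts a) : V).
    have /card_eqPle[la _] := card_El a.
    have /card_eqPle[_ lb] := card_El (cardinal_of (elts a) : V).
    have /card_eqPle[_ lk] := card_El kappa.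
    have al := card_le_trans la (card_le_trans apow lb).
    apply: card_le_trans (card_le_bool_fun al) _.
    apply: card_le_trans ple _; apply: card_le_trans lk.
    by apply: leV_card_le => //; left; exact: pow2_inaccessible.
  move=> /card_le_relP[R [Rex Rinj]].
  have Rex' X : exists k, R (restr X) k by have [k _ Rk] := Rex (restr X) I; exists k.
  have [c cP] := choice Rex'; exists c => X Y cXY b ba.
  have restrE : restr X = restr Y.
    by apply: (Rinj _ _ (c X)) => //; rewrite cXY.
  have := congr1 (@^~ (to_El ba)) restrE; rewrite /restr.
  by case: (incl _) => b' /= /elt_val_inj ->.
have [F FP] := choice code; exists (fun X al => F al X) => X Y XY.
have [b Xb] : exists b, X b <> Y b.
  apply: contrapT => nb; apply: XY; apply/funext => b.
  by apply: contrapT => Xb; apply: nb; exists b.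
have [c cP] := bounded_not_above b; exists c => al /= FXY; apply: cP => /= bal.
exact: Xb (FP _ _ _ FXY _ bal).
Qed.

(** The image of h(al) under the transposition of one of its elements with f(al)
    contains f(al) and has the size of h(al). *)
Lemma slalom_through (h f : K -> K) : (forall al, elts (elt_val (h al)) !=set0) ->
  exists2 phi, slalom h phi & forall al, exists2 S, phi al = Some S & S (f al).
Proof.
move=> h0; have ok := inaccessible_ordinal.
have S_ex al : exists S : set K, S #= elts (elt_val (h al)) /\ S (f al).
  have [z zh] := h0 al.
  pose sw x := if `[< x = z >] then elt_val (f al)
               else if `[< x = elt_val (f al) >] then z else x.
  have swz : sw z = elt_val (f al) by rewrite /sw asboolT.
  have swf : sw (elt_val (f al)) = z.
    by rewrite /sw; case: asboolP => // _; rewrite asboolT.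
  have swK x : sw (sw x) = x.
    have [->|xz] := pselect (x = z); first by rewrite swz.
    have [->|xf] := pselect (x = elt_val (f al)); first by rewrite swf.
    have swx : sw x = x by rewrite /sw !asboolF.
    by rewrite !swx.
  have hk := ok.1 _ _ (elt_valP (h al)).
  have swk x : x \inV kappa -> sw x \inV kappa.
    rewrite /sw; case: asboolP => _ xk; first exact: elt_valP.
    by case: asboolP => _ //; exact: hk.
  exists [set k | elts (elt_val (h al)) (sw (elt_val k))]; split=> /=; last first.
    by rewrite swf.
  have hE : elts (elt_val (h al)) = (sw \o @elt_val V kappa) @`
      [set k | elts (elt_val (h al)) (sw (elt_val k))].
    apply/seteqP; split=> [y yh|_ [k ? <-]//].
    by exists (to_El (swk _ (hk _ yh))); rewrite /= swK.
  rewrite [X in _ #= X]hE card_eq_sym; apply: inj_card_eq => k l _ _ /= /(can_inj swK).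
  exact: elt_val_inj.
have [S SP] := choice S_ex; exists (fun al => Some (S al)); last first.
  by move=> al; exists (S al) => //; case: (SP al).
split; last by move=> al _ [<-]; case: (SP al).
have [b _] := infinite_setN0 infinite_El; exists b => al /=.
by move=> /contrapT.
Qed.

Lemma small_slaloms (A : set (K -> option (set K))) : small V A.
Proof.
have sK := small_El kappa.
apply: small_le (small_power (small_setX sK (small_power sK))).
apply: (@card_le_inj _ _ _ _ (fun phi => [set p | phi p.1 = Some p.2])).
  by move=> phi _ [al S].
move=> phi psi _ _ e; apply/funext => al.
have eP S : phi al = Some S <-> psi al = Some S.
  by have := congr1 (@^~ (al, S)) e => /= ->.
case E: (phi al) => [S|]; first by apply/esym/eP.
by case E': (psi al) => [S|] //; move/eP: E'; rewrite E.
Qed.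

End Inaccessible.

(** * Slaloms in the ultrapower *)

Section Invariants.
Variables (V : zfcType) (kappa : V).
Local Notation K := (El kappa).
Variables (I U : set_system K) (h : K -> K).
Hypotheses (kappa_inaccessible : inaccessible kappa)
  (I_bounded : bounded_ideal `<=` I)
  (U_ultra : UltraFilter U) (U_sigma : sigma_complete U)
  (U_dual : dual_filter I `<=` U).

Local Notation cls := (collapse U).
Local Notation hU := (ult_class U h).
Local Notation lambda := (succ_card_in (ultrapower U) hU).
Let hplus (al : K) : V := succ_card (elt_val (h al)).

Lemma ideal_complement (A : set K) : I A -> U (~` A).
Proof. by move=> IA; apply: U_dual; rewrite /dual_filter /= setCK. Qed.

Let filterI2 (A B : set K) : U A -> U B -> U (A `&` B).
Proof. exact: filterI. Qed.

Lemma ult_rep (g : K -> V) : U [set al | g al \inV kappa] ->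
  exists f : K -> K, cls (fun al => elt_val (f al)) = cls g.
Proof.
move=> gk; have rep al : exists k : K, g al \inV kappa -> elt_val k = g al.
  have [ga|nga] := pselect (g al \inV kappa); last by exists al.
  by exists (to_El ga).
have [f fP] := choice rep; exists f; apply: cls_eq => //.
by apply: filterS gk => al; exact: fP.
Qed.

Let hU_ordinal : ordinal_set hU.
Proof. by apply: cls_ordinal => // al; exact: El_ordinal. Qed.

Let hplus_lt al : hplus al \inV kappa.
Proof. exact: succ_card_inaccessible (elt_valP (h al)). Qed.

(** A bijection in M_U is a bijection in V, so the successor of [h]_U in V is
    also a cardinal of M_U. *)
Lemma ult_succ_cardP : [/\ cardinal_in (ultrapower U) lambda,
  hU \inV lambda & lambda <=V succ_card hU].
Proof.
have [cs hs _] := succ_cardP hU_ordinal; have os := cardinal_ord cs.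
have cs' : cardinal_in (ultrapower U) (succ_card hU).
  split=> //; first exact: ordinal_ultrapower.
  by move=> b f bs _; case: cs => _ _; apply.
have [||[cl hl] l_min] :=
  @leastP V [set c | cardinal_in (ultrapower U) c /\ hU \inV c].
- by exists (succ_card hU).
- by move=> c [[]].
by split=> //; apply: l_min.
Qed.

(** If lambda were the class of some g below h+, then bijections from h(al) to
    g(al) would give one in M_U from [h]_U to lambda. *)
Lemma ult_hplus_le : cls hplus <=V lambda.
Proof.
have [[_ ol lP] hl _] := ult_succ_cardP.
apply: ord_notin => //.
  apply: cls_ordinal => // al.
  by have [/cardinal_ord] := succ_cardP (El_ordinal kappa_inaccessible (h al)).
move=> /(collapseP U_ultra U_sigma)[g ghp gl].
move: hl; rewrite -gl => /(cls_mem U_ultra U_sigma) hg.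
have /ultra_choice[e eP] : U [set al | exists e,
    bijection_from_to e (elt_val (h al)) (g al)].
  apply: filterS2 hg ghp => al /= hg ghp; apply/card_eq_bijection.
  exact: succ_card_equinumerous (El_ordinal kappa_inaccessible (h al)) hg ghp.
have := cls_bijection U_ultra U_sigma eP; rewrite gl; apply: lP.
  by rewrite -gl; apply/cls_mem.
by exists e.
Qed.

(** The unbounded family consists of one representative for each element of
    [h+]_U; it contains, modulo U, every function that picks a point of h+(al)
    outside of phi(al). *)
Lemma b_slalom_le : b_slalom h I <=V cardinal_of (elts lambda).
Proof.
have [[_ ol _] _ _] := ult_succ_cardP.
have rep x : exists f : K -> K,
    x \inV cls hplus -> cls (fun al => elt_val (f al)) = x.
  have [|nx] := pselect (x \inV cls hplus); last by exists id.
  move=> /(collapseP U_ultra U_sigma)[g gh <-].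
  have [|f fg] := @ult_rep g; last by exists f.
  apply: filterS gh => al /= gh.
  by have [k_tr _] := inaccessible_ordinal kappa_inaccessible; exact: k_tr gh.
have [r rP] := choice rep; pose F := r @` elts (cls hplus).
have FP phi : slalom h phi -> exists2 f, F f & ~ localized I f phi.
  move=> [dom_phi phi_card].
  have escape al : exists k : K, forall S, phi al = Some S ->
      elt_val k \inV hplus al /\ ~ S k.
    case phiE: (phi al) => [S|]; last by exists al.
    have [ch hh _] := succ_cardP (El_ordinal kappa_inaccessible (h al)).
    suff [k kh Sk] : exists2 k : K, elt_val k \inV hplus al & ~ S k.
      by exists k => _ [<-].
    apply: contrapT => nk; have oh := El_ordinal kappa_inaccessible (h al).
    apply: (leV_notin (card_le_leV ch oh _) hh).
    apply: (@card_le_trans _ _ _ S); last by have /card_eqPle[] := phi_card al S phiE.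
    have [k_tr _] := inaccessible_ordinal kappa_inaccessible.
    apply/card_le_relP; exists (fun x k => x = elt_val k).
    split=> [x xh|x x' k _ _ -> ->//].
    exists (to_El (k_tr _ _ (hplus_lt al) xh)) => //.
    by apply: contrapT => nS; apply: nk; exists (to_El (k_tr _ _ (hplus_lt al) xh)).
  have [g gP] := choice escape; pose x := cls (fun al => elt_val (g al)).
  have domU : U (slalom_dom phi).
    by rewrite -[slalom_dom phi]setCK; apply/ideal_complement/I_bounded.
  have xh : x \inV cls hplus.
    apply/(cls_mem U_ultra U_sigma); apply: filterS domU => al.
    rewrite /slalom_dom /=; case phiE: (phi al) => [S|//] _.
    by have [] := gP al S phiE.
  exists (r x); first by exists x.
  move=> /ideal_complement loc; have /(cls_inj U_ultra U_sigma) rg := rP x xh.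
  have /filter_ex[al [nloc [dom rgal]]] := filterI2 loc (filterI2 domU rg).
  apply: nloc; move: dom; rewrite /slalom_dom /=.
  case phiE: (phi al) => [S|//] _; exists S => //.
  by rewrite (elt_val_inj rgal); have [] := gP al S phiE.
have sl := small_elts lambda.
have Fl : F #<= elts lambda.
  apply: card_le_trans (card_image_le _ _) _; apply: leV_card_le => //.
  exact: ult_hplus_le.
have sKK (F' : set (K -> K)) : small V F'.
  by apply: small_sub (small_fun (small_El kappa) (small_El kappa)) => f _ al.
have [||_ b_min] := @leastP V [set c | exists F : set (K -> K),
    (forall phi, slalom h phi -> exists2 f, F f & ~ localized I f phi) /\
    c = cardinal_of F].
- by exists (cardinal_of F), F.
- by move=> c [F' [_ ->]]; have [/cardinal_ord] := cardinal_ofP (sKK F').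
have [/cardinal_ord ocl _] := cardinal_ofP sl.
apply: (leV_trans ocl) (cardinal_of_le sl Fl).
by apply: b_min; exists F.
Qed.

Lemma card_ult_succ_le : cardinal_of (elts lambda) <=V succ_card hU.
Proof.
have [[_ ol _] _ ls] := ult_succ_cardP.
have [cs _ _] := succ_cardP hU_ordinal; have os := cardinal_ord cs.
apply: cardinal_of_leV => //; first exact: small_elts.
exact: leV_card_le.
Qed.

(** If X and Y are sent to the same slalom phi and to the same class, then f_X
    and f_Y have almost everywhere the same image under the fixed injection of
    phi(al), hence are equal almost everywhere, and X = Y. *)
Lemma bool_fun_le_slaloms (A : set (K -> option (set K))) : A `<=` slalom h ->
  (forall f, exists2 phi, A phi & localized I f phi) ->
  [set: K -> bool] #<= A `*` elts hU.
Proof.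
move=> A_slalom A_loc.
have [F FP] := eventually_different_family kappa_inaccessible.
(* the fixed bijections of phi(al) with h(al) *)
have enum (p : (K -> option (set K)) * K) : exists e : K -> V, forall S,
    slalom h p.1 -> p.1 p.2 = Some S ->
    (forall k, S k -> e k \inV elt_val (h p.2)) /\
    (forall k l, S k -> S l -> e k = e l -> k = l).
  case: p => phi al /=.
  have [[sphi S_ex]|n] := pselect (slalom h phi /\ exists S, phi al = Some S).
    case: S_ex => S phiE; have /card_eq_funP[e [eh e_inj _]] := sphi.2 al S phiE.
    by exists e => S' _; rewrite phiE => -[<-].
  by exists (fun _ => point) => S sphi phiE; case: n; split=> //; exists S.
have [e eP] := choice enum.
pose code X (p : (K -> option (set K)) * V) := exists g : K -> V,
  U [set al | exists S, [/\ p.1 al = Some S, S (F X al) & g al = e (p.1, al) (F X al)]]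
  /\ slalom h p.1 /\ p.2 = cls g.
apply/card_le_relP; exists code; split=> [X _|X Y [phi y] _ _].
  have [phi Aphi loc] := A_loc (F X); have sphi := A_slalom _ Aphi.
  pose g al := e (phi, al) (F X al).
  have domU : U (slalom_dom phi).
    by rewrite -[slalom_dom phi]setCK; apply/ideal_complement/I_bounded; case: sphi.
  have gP : U [set al | exists S,
      [/\ phi al = Some S, S (F X al) & g al = e (phi, al) (F X al)]].
    apply: filterS2 domU (ideal_complement loc) => al; rewrite /slalom_dom /=.
    case phiE: (phi al) => [S|//] _ nloc; exists S; split=> //.
    by apply: contrapT => nS; apply: nloc; exists S.
  exists (phi, cls g); last by exists g.
  split=> //=; apply/(cls_mem U_ultra U_sigma).
  apply: filterS gP => al /= [S [phiE SF ->]].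
  by apply: (eP (phi, al) S _ _).1.
move=> [g [/= gP [sphi ->]]] [g' [/= g'P [_ /(cls_inj U_ultra U_sigma) gg']]].
apply: contrapT => /FP/I_bounded/ideal_complement XY.
have /filter_ex[al /= [XYal [gg'al [[S [phiE SX gE]] [S' [phiE' SY gE']]]]]] :=
  filterI2 XY (filterI2 gg' (filterI2 gP g'P)).
apply: XYal => /=; move: phiE'; rewrite phiE => -[SS']; subst S'.
by apply: (eP (phi, al) S sphi phiE).2 => //; rewrite -gE -gE'.
Qed.

(** Elements of [h]_U are represented by functions from kappa to kappa, and
    kappa^kappa is at most 2^(kappa * kappa) = 2^kappa. *)
Lemma card_ult_class_le : elts hU #<= [set: K -> bool].
Proof.
have sK : small V [set: K] by exact: small_El.
apply: (@card_le_trans _ _ _ [set: K -> K]).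
  apply/card_le_relP; exists (fun x f => cls (fun al => elt_val (f al)) = x).
  split=> [_ /(collapseP U_ultra U_sigma)[g gh <-]|x x' f _ _ <-//].
  have [|f fg] := @ult_rep g; last by exists f.
  apply: filterS gh => al /= gh.
  have [k_tr _] := inaccessible_ordinal kappa_inaccessible.
  exact: k_tr (elt_valP _) gh.
apply: (@card_le_trans _ _ _ [set: K * K -> bool]).
  apply: (@card_le_inj _ _ _ _ (fun f p => `[< p.2 = f p.1 >])) => // f g _ _ fg.
  apply/funext => al; have := congr1 (@^~ (al, f al)) fg => /=.
  by rewrite asboolT// => /esym/asboolP.
apply: card_le_bool_fun; rewrite -setXTT; apply: card_square_le sK _.
exact: infinite_El.
Qed.

(** In an infinite product bound 2^kappa <= |A| * |[h]_U| one of the factors is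
    already at least 2^kappa, and it is not A. *)
Lemma pow2_eq_card_ult_class : (forall al, elts (elt_val (h al)) !=set0) ->
  d_slalom h I \inV pow2 kappa -> pow2 kappa = cardinal_of (elts hU).
Proof.
move=> h0 d_lt; have I0 : I set0.
  apply: I_bounded; have [b _] := infinite_setN0 (infinite_El kappa_inaccessible).
  by exists b.
have [||[A [A_slalom A_loc dA]] _] := @leastP V [set c | exists A,
    [/\ A `<=` slalom h,
        forall f : K -> K, exists2 phi, A phi & localized I f phi &
        c = cardinal_of A]].
- exists (cardinal_of (slalom h)), (slalom h); split=> // f.
  have [phi sphi phiP] := slalom_through kappa_inaccessible f h0; exists phi => //.
  rewrite /localized (_ : [set al | _] = set0)//.
  apply/seteqP; split=> // al [S phiE nS]; have [S'] := phiP al.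
  by rewrite phiE => -[<-].
- by move=> c [A [_ _ ->]]; have [/cardinal_ord] := cardinal_ofP (small_slaloms A).
have sA : small V A by exact: small_slaloms.
rewrite -/(d_slalom h I) in dA.
have infP : infinite_set [set: K -> bool].
  move=> fP; apply: (infinite_El kappa_inaccessible); apply: card_le_finite fP.
  apply: (@card_le_inj _ _ _ _ (fun k l => `[< l = k >])) => // k l _ _ kl.
  by have := congr1 (@^~ k) kl => /=; rewrite asboolT// => /esym/asboolP.
have PAh := bool_fun_le_slaloms A_slalom A_loc.
have [PA|Ph] := card_le_setX_or sA (small_elts hU) infP PAh.
  by case: (leV_notin (cardinal_of_le sA PA)); rewrite -dA.
by apply: cardinal_of_eq; apply/card_eqPle; split=> //; exact: card_ult_class_le.
Qed.

End Invariants.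

Theorem corollary3p6 (V : zfcType) (kappa : V)
    (I U : set_system (El kappa)) (h : El kappa -> El kappa)
    (kappa_inaccessible : inaccessible kappa)
    (I_ideal : is_ideal I) (I_bounded : bounded_ideal `<=` I)
    (U_ultra : UltraFilter U) (U_sigma : sigma_complete U)
    (U_dual : dual_filter I `<=` U)
    (h_infinite : forall al, infinite_set (elts (elt_val (h al)))) :
  (b_slalom h I <=V cardinal_of (elts (succ_card_in (ultrapower U) (ult_class U h)))
   /\ cardinal_of (elts (succ_card_in (ultrapower U) (ult_class U h)))
        <=V succ_card (ult_class U h)) /\
  (d_slalom h I \inV pow2 kappa ->
   pow2 kappa = cardinal_of (elts (ult_class U h))).
Proof.
split; last by apply: pow2_eq_card_ult_class => // al; exact/infinite_setN0.
by split; [exact: b_slalom_le|exact: card_ult_succ_le].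
Qed.
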